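(* Let $P\subset\mathbb{R}^d$ be a full-dimensional centrally symmetric polytope and let $a,b\in\mathbb{R}^d$ be points in general position. If $a$ and $b$ are separated by a hyperplane in $\mathcal{H}_P$ or lie in different maximal cones of $\mathcal{F}_P$, then $\operatorname{bis}(0,a)$ and $\operatorname{bis}(0,b)$ are not equivalent.
   Context: $P=-P$ is a full-dimensional convex polytope in $\mathbb{R}^d$. Its distance function is $\operatorname{dist}(a,b)=\min\{\alpha\ge 0 : b-a\in\alpha P\}$. For $a,b\in\mathbb{R}^d$ the bisector is $\operatorname{bis}(a,b)=\{x\in\mathbb{R}^d:\operatorname{dist}(a,x)=\operatorname{dist}(b,x)\}$. For a face $F$ of $P$, $C_F=\operatorname{cone}(F)$ is the set of all finite nonnegative linear combinations of points of $F$. For facets $F,G$, $\operatorname{bis}_{F,G}(a,b)=\operatorname{bis}(a,b)\cap(C_F+a)\cap(C_G+b)$. Two bisectors $\operatorname{bis}(a,b)$ and $\operatorname{bis}(a',b')$ are equivalent if for all facets $F,G$ of $P$: $\operatorname{bis}_{F,G}(a,b)\ne\emptyset \Leftrightarrow \operatorname{bis}_{F,G}(a',b')\neq\emptyset$. A point $c\in\mathbb{R}^d$ is in general position if there is a neighborhood $U$ of $c$ such that $\operatorname{bis}(0,c)$ is equivalent to $\operatorname{bis}(0,c')$ for all $c'\in U$. $\mathcal{H}_P$ is the arrangement of all hyperplanes through the origin that are parallel to a facet of $P$. $\mathcal{F}_P=\{C_F: F\subsetneq P \text{ a face}\}$ is the face fan of $P$; its maximal cones are the $C_F$ with $F$ a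 facet. *)

(* Defs.v *)
From HB Require Import structures.
From mathcomp Require Import all_boot all_order all_algebra.
From mathcomp Require Import all_classical all_reals all_analysis.

Set Implicit Arguments.
Unset Strict Implicit.
Unset Printing Implicit Defensive.

Import Order.TTheory GRing.Theory Num.Theory.
Import numFieldNormedType.Exports.

Local Open Scope classical_set_scope.
Local Open Scope ring_scope.

Section PolyhedralBisectors.
Context {R : realType} {d : nat}.
Local Notation E := 'rV[R]_d.
Implicit Types (P F G A C : set E) (H U W : {vspace E}) (a b c x : E).

Definition convex_hull A : set E :=
  [set x | exists n (v : 'I_n -> E) (w : 'I_n -> R),
     [/\ forall i, A (v i), forall i, 0 <= w i, \sum_i w i = 1
       & x = \sum_i w i *: v i]].

(* [n = 0] is allowed, so [cone set0] is the zero cone. *)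
Definition cone A : set E :=
  [set x | exists n (v : 'I_n -> E) (w : 'I_n -> R),
     [/\ forall i, A (v i), forall i, 0 <= w i
       & x = \sum_i w i *: v i]].

Definition polytope P : Prop :=
  exists2 V : set E, finite_set V & P = convex_hull V.

Definition centrally_symmetric P : Prop := P = [set - x | x in P].

(* [U] is the linear subspace parallel to the affine hull of [A]. *)
Definition direction A U : Prop :=
  (forall x y, A x -> A y -> x - y \in U) /\
  (forall W, (forall x y, A x -> A y -> x - y \in W) -> (U <= W)%VS).

Definition affine_dim A (k : nat) : Prop :=
  A !=set0 /\ exists2 U, direction A U & \dim U = k.

(* The empty set ([f = 0], [t = 1]) and [P] ([f = 0], [t = 0]) are faces. *)
Definition face P F : Prop :=
  exists (f : {scalar E}) (t : R),
    (forall x, P x -> f x <= t) /\ F = P `&` [set x | f x = t].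

(* [k.+1 = d] rather than [k = d.-1], because of [d = 0]. *)
Definition facet P F : Prop :=
  face P F /\ exists2 k, affine_dim F k & k.+1 = d.

Definition scale (t : R) P : set E := [set t *: x | x in P].

Definition translate A a : set E := [set x + a | x in A].

(* The least element of the set of admissible factors; the default value 0 is
   returned only if there is no least element, which does not happen when [P]
   is a full-dimensional centrally symmetric polytope. *)
Definition dist P a b : R :=
  let S := [set t : R | 0 <= t /\ scale t P (b - a)] in
  xget 0 (S `&` lbound S).

Definition bis P a b : set E := [set x | dist P a x = dist P b x].

Definition bis_facets P F G a b : set E :=
  bis P a b `&` translate (cone F) a `&` translate (cone G) b.

(* Equivalence of [bis P a b] and [bis P a' b']. *)
Definition bis_equiv P a b a' b' : Prop :=
  forall F G, facet P F -> facet P G ->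
    (bis_facets P F G a b !=set0 <-> bis_facets P F G a' b' !=set0).

Definition general_position P c : Prop :=
  \forall c' \near c, bis_equiv P 0 c 0 c'.

Definition facet_arrangement P : set {vspace E} :=
  [set H | (\dim H).+1 = d /\
     exists2 F, facet P F & forall x y, F x -> F y -> x - y \in H].

(* [a] and [b] lie in opposite open half-spaces of the linear hyperplane [H]. *)
Definition separates H a b : Prop :=
  exists f : {scalar E},
    (forall x, x \in H <-> f x = 0) /\ f a * f b < 0.

Definition face_fan P : set (set E) :=
  [set C | exists F, [/\ face P F, F `<` P & C = cone F]].

Definition maximal_cone P C : Prop :=
  face_fan P C /\ forall C', face_fan P C' -> C `<=` C' -> C' = C.

End PolyhedralBisectors.

(* Main.v *)
(* If x lies in the cone of the facet F = P /\ {g = 1}, then dist 0 x = g x,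
   while g x <= dist 0 x always. Hence, if bis_{F,G}(0, a) is nonempty for some
   facet G, then g a >= 0; conversely g a > 0 forces bis_{F,G}(0, a) to be
   nonempty for some G, by the intermediate value theorem on a ray of cone F.
   So the equivalence class of bis(0, a) controls the side of the hyperplane
   {g = 0} on which a lies. Moreover bis_{F,-F}(0, a) is nonempty if and only if
   a is in cone F (the midpoint of 0 and a is then a witness), so the class also
   determines the facet cones containing a; in general position a lies in the
   interior of such a cone, which is therefore unique.

   That the facet cones cover the space follows from Farkas' lemma at a vertex
   of the polar polytope that maximises the linear form defined by x. *)
From HB Require Import structures.
Require Import Defs.
From mathcomp Require Import all_boot all_order all_algebra.
From mathcomp Require Import all_classical all_reals all_analysis.
From mathcomp Require Import ring lra.

Set Implicit Arguments.
Unset Strict Implicit.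
Unset Printing Implicit Defensive.

Import Order.TTheory GRing.Theory Num.Theory.
Import numFieldNormedType.Exports.

Local Open Scope classical_set_scope.
Local Open Scope ring_scope.

(** * Linear forms as row vectors *)

Section Dot.
Context {R : realType} {d : nat}.
Local Notation E := 'rV[R]_d.
Implicit Types (g h x y : E).

(** Representing forms by vectors lets them be added, scaled and perturbed like points; [scalar_dot]
    shows that no form is lost. *)
Definition dot g x : R := \sum_i g 0 i * x 0 i.

Lemma dotC g x : dot g x = dot x g.
Proof. by apply: eq_bigr => i _; rewrite mulrC. Qed.

Lemma dot_is_scalar g : scalar (dot g).
Proof.
move=> t x y; rewrite /dot mulr_sumr -big_split /=; apply: eq_bigr => i _.
by rewrite !mxE mulrDr mulrCA.
Qed.

HB.instance Definition _ g :=
  GRing.isLinear.Build R E R *%R (dot g) (dot_is_scalar g).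

Lemma dotDr g x y : dot g (x + y) = dot g x + dot g y.
Proof. exact: linearD. Qed.

Lemma dotBr g x y : dot g (x - y) = dot g x - dot g y.
Proof. exact: linearB. Qed.

Lemma dotNr g x : dot g (- x) = - dot g x.
Proof. exact: linearN. Qed.

Lemma dotZr g t x : dot g (t *: x) = t * dot g x.
Proof. exact: linearZ. Qed.

Lemma dot0r g : dot g 0 = 0.
Proof. exact: linear0. Qed.

Lemma dotDl g h x : dot (g + h) x = dot g x + dot h x.
Proof. by rewrite ![dot _ x]dotC dotDr. Qed.

Lemma dotBl g h x : dot (g - h) x = dot g x - dot h x.
Proof. by rewrite ![dot _ x]dotC dotBr. Qed.

Lemma dotNl g x : dot (- g) x = - dot g x.
Proof. by rewrite ![dot _ x]dotC dotNr. Qed.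

Lemma dotZl t g x : dot (t *: g) x = t * dot g x.
Proof. by rewrite ![dot _ x]dotC dotZr. Qed.

Lemma dot0l x : dot 0 x = 0.
Proof. by rewrite dotC dot0r. Qed.

Lemma dot_eq0 g : (forall x, dot g x = 0) -> g = 0.
Proof.
move=> g0; apply/rowP => i; rewrite mxE -[RHS](g0 (delta_mx 0 i)) /dot.
rewrite (bigD1 i) //= mxE !eqxx mulr1 big1 ?addr0 // => j ji.
by rewrite mxE (negbTE ji) andbF mulr0.
Qed.

Lemma scalar_dot (f : {scalar E}) : exists g, f =1 dot g.
Proof.
exists (\row_i f (delta_mx 0 i)) => x.
rewrite {1}(row_sum_delta x) linear_sum; apply: eq_bigr => i _.
by rewrite linearZ /= mxE mulrC.
Qed.

End Dot.

(** * Cones, convex hulls and Farkas' lemma *)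

Section Cone.
Context {R : realType} {d : nat}.
Local Notation E := 'rV[R]_d.
Implicit Types (A B : set E) (g h x y : E) (t u : R).

(* [cone A] graded by the total weight, so that [wcone A 1] is the convex hull
   of [A]. *)
Definition wcone A t : set E :=
  [set x | exists n (v : 'I_n -> E) (w : 'I_n -> R),
     [/\ forall i, A (v i), forall i, 0 <= w i, \sum_i w i = t
       & x = \sum_i w i *: v i]].

Lemma coneP A x : cone A x <-> exists t, wcone A t x.
Proof.
split=> [[n [v [w [? ? ->]]]]|[t [n [v [w [? ? _ ->]]]]]].
  by exists (\sum_i w i), n, v, w.
by exists n, v, w.
Qed.

Lemma wconeW A t x : wcone A t x -> cone A x.
Proof. by move=> Ax; apply/coneP; exists t. Qed.

(** Induction replacing explicit sums over generators. The predicate also sees the weight, so it can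
    compare a linear form with it. *)
Lemma wcone_elim A (K : R -> E -> Prop) :
  K 0 0 ->
  (forall t x u y, K t x -> K u y -> K (t + u) (x + y)) ->
  (forall t x, 0 <= t -> A x -> K t (t *: x)) ->
  forall t x, wcone A t x -> K t x.
Proof.
move=> K0 KD KZ t x [n [v [w [Av w0 <- ->]]]].
elim/big_ind2: _ => //; first by move=> *; apply: KD.
by move=> i _; apply: KZ.
Qed.

Lemma wcone0 A : wcone A 0 0.
Proof.
by exists 0, (fun=> 0), (fun=> 0); split; rewrite ?big_ord0 //; case.
Qed.

Lemma wconeD A t x u y :
  wcone A t x -> wcone A u y -> wcone A (t + u) (x + y).
Proof.
move=> [n [v [w [Av w0 <- ->]]]] [m [v' [w' [Av' w0' <- ->]]]].
pose glue T (p : 'I_n -> T) (q : 'I_m -> T) (i : 'I_(n + m)) :=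
  match fintype.split i with inl j => p j | inr j => q j end.
exists (n + m)%N, (glue _ v v'), (glue _ w w'); rewrite /glue; split.
- by move=> i; case: fintype.split.
- by move=> i; case: fintype.split.
- by rewrite big_split_ord /=; congr (_ + _); apply: eq_bigr => i _;
    rewrite ?(unsplitK (inl i)) ?(unsplitK (inr i)).
- by rewrite big_split_ord /=; congr (_ + _); apply: eq_bigr => i _;
    rewrite ?(unsplitK (inl i)) ?(unsplitK (inr i)).
Qed.

Lemma wconeZ A c t x : 0 <= c -> wcone A t x -> wcone A (c * t) (c *: x).
Proof.
move=> c0 [n [v [w [Av w0 <- ->]]]].
exists n, v, (fun i => c * w i); split=> //.
- by move=> i; rewrite mulr_ge0.
- by rewrite mulr_sumr.
- by rewrite scaler_sumr; apply: eq_bigr => i _; rewrite scalerA.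
Qed.

Lemma wcone_mem A x : A x -> wcone A 1 x.
Proof.
by exists 1%N, (fun=> x), (fun=> 1); split; rewrite ?big_ord1 ?scale1r.
Qed.

Lemma wcone_trans A B t x :
  A `<=` wcone B 1 -> wcone A t x -> wcone B t x.
Proof.
move=> AB; apply: wcone_elim => [||u y u0 /AB By]; first exact: wcone0.
  by move=> *; apply: wconeD.
by rewrite -[u in wcone B u]mulr1; exact: wconeZ.
Qed.

Lemma wcone_ge0 A t x : wcone A t x -> 0 <= t.
Proof. by move=> [n [v [w [_ w0 <- _]]]]; apply: sumr_ge0. Qed.

Lemma wcone_eq0 A x : wcone A 0 x -> x = 0.
Proof.
move=> [n [v [w [_ w0 /eqP w_eq0 ->]]]]; apply: big1 => i _.
move: w_eq0; rewrite psumr_eq0 // => /allP /(_ i); rewrite mem_index_enum.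
by move=> /(_ isT) /eqP ->; rewrite scale0r.
Qed.

Lemma wcone_dot_le A g c t x :
  (forall y, A y -> dot g y <= c) -> wcone A t x -> dot g x <= t * c.
Proof.
move=> gA; apply: (@wcone_elim A (fun t x => dot g x <= t * c)).
- by rewrite dot0r mul0r.
- by move=> ? ? ? ? ? ?; rewrite dotDr mulrDl lerD.
- by move=> u y u0 Ay; rewrite dotZr ler_wpM2l ?gA.
Qed.

Lemma wcone_dot_eq A g c t x :
  (forall y, A y -> dot g y = c) -> wcone A t x -> dot g x = t * c.
Proof.
move=> gA; apply: (@wcone_elim A (fun t x => dot g x = t * c)).
- by rewrite dot0r mul0r.
- by move=> ? ? ? ? H H'; rewrite dotDr H H' mulrDl.
- by move=> u y u0 Ay; rewrite dotZr gA.
Qed.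

Lemma cone0 A : cone A 0.
Proof. exact: wconeW (wcone0 A). Qed.

Lemma coneD A x y : cone A x -> cone A y -> cone A (x + y).
Proof.
by move=> /coneP[t xt] /coneP[u yu]; apply: wconeW (wconeD xt yu).
Qed.

Lemma coneZ A c x : 0 <= c -> cone A x -> cone A (c *: x).
Proof. by move=> c0 /coneP[t xt]; apply: wconeW (wconeZ c0 xt). Qed.

Lemma cone_mem A x : A x -> cone A x.
Proof. by move=> /wcone_mem; apply: wconeW. Qed.

Lemma cone_trans A B x : A `<=` cone B -> cone A x -> cone B x.
Proof.
move=> AB /coneP[t].
apply: (@wcone_elim A (fun _ x => cone B x)) => [||u y u0 /AB By].
- exact: cone0.
  by move=> *; apply: coneD.
exact: coneZ.
Qed.

Lemma coneN A x : cone [set - y | y in A] x -> cone A (- x).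
Proof.
move=> /coneP[t].
apply: (@wcone_elim _ (fun _ x => cone A (- x)))
  => [|u y u' y' H H'|u _ u0 [y Ay <-]].
- by rewrite oppr0; apply: cone0.
- by rewrite opprD; apply: coneD.
- by rewrite scalerN opprK; apply/coneZ/cone_mem.
Qed.

(* Induction on the number of generators: if a separating [f] for the tail is
   negative at the head [a], project everything to [ker f] along [a]. *)
Lemma farkas (s : seq E) b : ~ cone [set` s] b ->
  exists2 f, forall a, a \in s -> 0 <= dot f a & dot f b < 0.
Proof.
have [n] := ubnP (size s); elim: n s b => // n IH [|a s] b /= sn bs.
  exists (- b) => //; rewrite dotNl oppr_lt0 /dot.
  rewrite lt_neqAle sumr_ge0 ?andbT; last by move=> i _; rewrite -expr2 sqr_ge0.
  apply/eqP => /esym /eqP; rewrite psumr_eq0; last first.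
    by move=> i _; rewrite -expr2 sqr_ge0.
  move=> /allP b0; apply: bs; suff -> : b = 0 by apply: cone0.
  apply/rowP => i; rewrite mxE; have := b0 i (mem_index_enum _).
  by rewrite mulf_eq0 orbb => /eqP.
have {bs} bs' : forall c, 0 <= c -> ~ cone [set` s] (b - c *: a).
  move=> c c0 bs'; apply: bs; rewrite -[b](subrK (c *: a)); apply: coneD.
    apply: cone_trans bs' => x /= xs; apply: cone_mem.
    by rewrite /= inE xs orbT.
  by apply/coneZ/cone_mem => //=; rewrite inE eqxx.
have [|f fs fb] := IH s b sn.
  by have := bs' 0; rewrite scale0r subr0; apply.
have [fa|fa] := leP 0 (dot f a).
  by exists f => // x; rewrite inE => /predU1P[->|/fs].
pose p x := x - (dot f x / dot f a) *: a.
have [||g gs gb] := IH (map p s) (p b); first by rewrite size_map.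
  have c0 : 0 <= dot f b / dot f a by rewrite mulr_le0 ?invr_le0 ?ltW.
  have bs := bs' 0 (lexx _); rewrite scale0r subr0 in bs.
  move=> /coneP[t] Hpb.
  (* On the tail, [p] adds nonnegative multiples of [a], because [f] is nonnegative there and
     negative at [a]; [c] collects these multiples. *)
  suff [c c0' H] : exists2 c, 0 <= c & cone [set` s] (p b - c *: a).
    apply: (bs' (dot f b / dot f a + c)); first by rewrite addr_ge0.
    by rewrite scalerDl opprD addrA.
  move: t (p b) Hpb; apply: wcone_elim.
  - by exists 0 => //; rewrite scale0r subr0; apply: cone0.
  - move=> _ x _ y [c c0' Hc] [c' c0'' Hc'].
    exists (c + c'); first by rewrite addr_ge0.
    by rewrite scalerDl opprD addrACA; apply: coneD.
  - move=> u _ u0 /mapP[v vs ->]; exists (- (u * (dot f v / dot f a))).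
      rewrite oppr_ge0 mulr_ge0_le0 // mulr_ge0_le0 ?fs //.
      by rewrite invr_le0 ltW.
    rewrite scaleNr opprK scalerBr scalerA subrK.
    by apply/coneZ/cone_mem.
(* This form is [g] composed with [p], hence zero at [a]. *)
exists (g - (dot g a / dot f a) *: f) => [x|].
  rewrite inE dotBl dotZl => /predU1P[->|xs].
    by rewrite divfK ?subrr // lt_eqF.
  have := gs (p x) (map_f _ xs); rewrite dotBr dotZr.
  suff -> : dot f x / dot f a * dot g a = dot g a / dot f a * dot f x by [].
  by ring.
rewrite dotBl dotZl; move: gb; rewrite dotBr dotZr.
suff -> : dot f b / dot f a * dot g a = dot g a / dot f a * dot f b by [].
by ring.
Qed.

End Cone.

(** * Vertices of the polar polytope and their normal cones *)

Section PolarVertex.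
Context {R : realType} {d : nat}.
Local Notation E := 'rV[R]_d.
Implicit Types (s : seq E) (g h v x : E).

Definition polar s g := forall v, v \in s -> dot g v <= 1.

(** A vertex is encoded algebraically: the generators tight at [g] span the whole space. *)
Definition polar_vertex s g :=
  polar s g /\
  forall h, (forall v, v \in s -> dot g v = 1 -> dot h v = 0) -> h = 0.

(** Finitely many strict inequalities leave a common positive slack. *)
Lemma small_perturbation s g h : polar s g ->
  exists2 e : R, 0 < e &
    forall v, v \in s -> dot g v < 1 -> dot g v + e * dot h v <= 1.
Proof.
elim: s => [|v s IH] gs; first by exists 1.
have [|e e0 he] := IH; first by move=> u us; rewrite gs // inE us orbT.
have gv : dot g v <= 1 by rewrite gs // inE eqxx.
have h1 : 0 < `|dot h v| + 1 by rewrite ltr_wpDl.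
case: (ltP (dot g v) 1) => gv1; last first.
  by exists e => // u; rewrite inE => /predU1P[->|/he//]; rewrite ltNge gv1.
(* A step of this length uses up at most the slack at [v]; the [+ 1] keeps the divisor positive. *)
pose e' := (1 - dot g v) / (`|dot h v| + 1).
have e'0 : 0 < e' by rewrite divr_gt0 ?subr_gt0.
have m0 : 0 < Num.min e e' by rewrite lt_min e0.
exists (Num.min e e') => // u; rewrite inE => /predU1P[-> _|us u1].
  rewrite addrC -lerBrDr (le_trans (ler_norm _)) // normrM (gtr0_norm m0).
  apply: (@le_trans _ _ (e' * (`|dot h v| + 1))); last by rewrite divfK ?gt_eqF.
  by apply: ler_pM; rewrite ?ge_min ?lexx ?orbT ?lerDl // ltW.
have [hu|hu] := leP (dot h u) 0.
  by rewrite (le_trans _ (ltW u1)) // gerDl mulr_ge0_le0 // ltW.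
rewrite (le_trans _ (he u us u1)) // lerD2l ler_wpM2r ?ge_min ?lexx //.
exact: ltW.
Qed.

(** As in the simplex method: while the tight generators do not span, move along a form vanishing on
    them without decreasing the value at [x], until a further generator becomes tight. The number of
    slack generators drops. *)
Lemma polar_vertex_above s x g :
  (forall h, (forall v, v \in s -> dot h v <= 0) -> h = 0) ->
  polar s g -> exists2 g', polar_vertex s g' & dot g x <= dot g' x.
Proof.
move=> s_full; have [n] := ubnP (count (fun v => dot g v != 1) s).
elim: n g => // n IH g sn gs.
have [|] := pselect (forall h,
    (forall v, v \in s -> dot g v = 1 -> dot h v = 0) -> h = 0).
  by exists g.
move=> /existsNP[h0 /not_implyP[h0g h0_neq0]].
have [h [h_neq0 hg hx]] : exists h, [/\ h <> 0,
    (forall v, v \in s -> dot g v = 1 -> dot h v = 0) & 0 <= dot h x].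
  have [?|?] := leP 0 (dot h0 x); first by exists h0.
  exists (- h0); split.
  - by move=> /eqP; rewrite oppr_eq0 => /eqP.
  - by move=> v vs /(h0g v vs) h0v; rewrite dotNl h0v oppr0.
  - by rewrite dotNl oppr_ge0 ltW.
have [v0 v0s hv0] : exists2 v, v \in s & 0 < dot h v.
  apply: contra_notP h_neq0 => H; apply: s_full => v vs.
  by rewrite leNgt; apply/negP => hv; apply: H; exists v.
pose i0 := Ordinal (etrans (index_mem v0 s) v0s).
(* Ratio test: [F i] is the step length at which generator [i] becomes tight, and the smallest one
   over positive [dot h] keeps [g] in the polar. *)
pose F (i : 'I_(size s)) := (1 - dot g s`_i) / dot h s`_i.
have Pi0 : 0 < dot h s`_i0 by rewrite nth_index.
have [i hi Fi] := @arg_minP _ _ _ i0 (fun i => 0 < dot h s`_i) F Pi0.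
have vs : s`_i \in s by rewrite mem_nth.
have l0 : 0 <= F i by rewrite divr_ge0 ?subr_ge0 ?gs // ltW.
have ge v : v \in s -> dot g v = 1 -> dot (g + F i *: h) v = 1.
  by move=> vs' gv; rewrite dotDl dotZl hg // mulr0 addr0.
have gi : dot (g + F i *: h) s`_i = 1.
  by rewrite dotDl dotZl divfK ?gt_eqF // subrKC.
have [||g' g'v g'x] := IH (g + F i *: h).
(* Tight generators stay tight and generator [i] joins them, so the slack ones form a strictly
   smaller part. *)
- rewrite -ltnS (leq_trans _ sn) // ltnS.
  set a := (X in (count X s < _)%N); set b := (X in (_ < count X s)%N).
  rewrite -[X in (_ < X)%N]size_filter -(count_predC a) count_filter.
  rewrite (@eq_in_count _ (predI a b) a s) => [|v vs' /=].
    rewrite -addn1 leq_add2l -has_count; apply/hasP; exists s`_i.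
      rewrite mem_filter vs /b /= andbT; apply/eqP => gvi.
      by move: hi; rewrite hg // ltxx.
    by rewrite /a /= gi eqxx.
  by apply/andb_idr; apply: contra => /eqP gv; apply/eqP/ge.
- move=> v vs'; rewrite dotDl dotZl.
  have [hv|hv] := leP (dot h v) 0.
    by rewrite (le_trans _ (gs v vs')) // gerDl mulr_ge0_le0.
  have /(_ (Ordinal (etrans (index_mem v s) vs'))) := Fi.
  rewrite /F /= nth_index // => /(_ hv).
  by rewrite ler_pdivlMr // => ?; rewrite addrC -lerBrDr.
exists g' => //; apply: le_trans g'x.
by rewrite dotDl dotZl lerDl mulr_ge0.
Qed.

(** A vertex is determined by its tight generators, so there are finitely many, and the best one for
    [x] maximises over the whole polar. Were [x] outside the cone of its tight generators, moving
    against the form given by Farkas' lemma would increase the value. *)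
Lemma exists_polar_vertex s x :
  (forall h, (forall v, v \in s -> dot h v <= 0) -> h = 0) ->
  exists2 g, polar_vertex s g & cone [set v | v \in s /\ dot g v = 1] x.
Proof.
move=> s_full.
have [g gv gmax] : exists2 g, polar_vertex s g &
    forall g', polar s g' -> dot g' x <= dot g x.
  pose act g : {set 'I_(size s)} := [set i : 'I_(size s) | dot g s`_i == 1]%SET.
  pose G (S : {set 'I_(size s)}) := [set g | polar_vertex s g /\ act g = S].
  have act_inj g g' : polar_vertex s g -> act g = act g' -> g = g'.
    move=> [_ gs] /setP gg'; apply/subr0_eq/gs => v vs gv.
    have := gg' (Ordinal (etrans (index_mem v s) vs)).
    rewrite !inE /= nth_index // gv eqxx => /esym /eqP g'v.
    by rewrite dotBl gv g'v subrr.
  (* Each [G S] has at most one element; the default 0 is harmless, as only nonempty [G S] are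
     compared. *)
  have Gget g : polar_vertex s g -> xget 0 (G (act g)) = g.
    by move=> gv; apply: xget_unique => // g' [g'v ?]; apply: act_inj.
  have [|g0 g0v _] := @polar_vertex_above s x 0 s_full.
    by move=> v _; rewrite dot0l.
  have PS0 : `[< G (act g0) !=set0 >] by apply/asboolP; exists g0.
  have [S /asboolP[g [gv gS]] Smax] := @arg_maxP _ _ _ (act g0)
    (fun S => `[< G S !=set0 >]) (fun S => dot (xget 0 (G S)) x) PS0.
  exists g => // g' /(polar_vertex_above x s_full)[h hv hx].
  apply: le_trans hx _; have := Smax (act h).
  rewrite -gS !Gget //; apply; apply/asboolP.
  by exists h.
exists g => //; apply: contrapT => gx.
have [|h hs hx] := @farkas R d [seq v <- s | dot g v == 1] x.
  apply: contra_not gx; apply: cone_trans => v /=.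
  by rewrite mem_filter => /andP[/eqP gv' vs]; apply: cone_mem.
have [gs _] := gv.
have [e e0 he] := small_perturbation (- h) gs.
have /gmax : polar s (g + e *: - h).
  move=> v vs; rewrite dotDl dotZl.
  have := gs v vs; rewrite le_eqVlt => /predU1P[gv1|/he]; last exact.
  rewrite gv1 gerDl dotNl mulrN oppr_le0 mulr_ge0 //; first exact: ltW.
  by apply: hs; rewrite mem_filter gv1 eqxx.
by rewrite dotDl dotZl dotNl gerDl pmulr_rle0 // oppr_le0 leNgt hx.
Qed.

End PolarVertex.

(** * Linear hyperplanes and separation from subspaces *)

Section Hyperplane.
Context {R : realType} {d : nat}.
Local Notation E := 'rV[R]_d.
Implicit Types (g h x z : E) (W : {vspace E}).

(** The codomain [R^o] is a vector space, as [linfun] and [lker] require. *)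
Definition dot_regular g (x : E) : R^o := dot g x.

Lemma dot_regular_linear g : linear (dot_regular g).
Proof. exact: dot_is_scalar. Qed.

HB.instance Definition _ g :=
  GRing.isLinear.Build R E R^o *:%R (dot_regular g) (dot_regular_linear g).

Definition hyperplane g : {vspace E} := lker (linfun (dot_regular g)).

Lemma mem_hyperplane g x : (x \in hyperplane g) = (dot g x == 0).
Proof. by rewrite memv_ker lfunE. Qed.

Lemma dim_hyperplane g : g <> 0 -> (\dim (hyperplane g)).+1 = d.
Proof.
move=> g0.
have := limg_ker_dim (linfun (dot_regular g)) fullv.
rewrite capfv dimvf /dim /= mul1n => dimE.
apply: etrans dimE; rewrite -addn1; congr (_ + _)%N; apply/esym/eqP.
rewrite eqn_leq; apply/andP; split.
  by rewrite (leq_trans (dimvS (subvf _))) // dimvf.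
rewrite lt0n dimv_eq0; apply/negP => /eqP im0; apply: g0; apply: dot_eq0 => x.
have := memv_img (linfun (dot_regular g)) (memvf x).
by rewrite im0 memv0 lfunE => /eqP.
Qed.

(** Farkas' lemma for a basis together with its negatives: their cone lies in [W], and a form
    nonnegative on them vanishes on [W]. *)
Lemma separate_vspace W z :
  (forall h, (forall x, x \in W -> dot h x = 0) -> dot h z = 0) -> z \in W.
Proof.
move=> sepz; apply: contrapT => zW.
pose s : seq E := vbasis W ++ map -%R (vbasis W).
have sW v : v \in s -> v \in W.
  rewrite mem_cat => /orP[/vbasis_mem//|/mapP[u /vbasis_mem uW ->]].
  by rewrite memvN.
have [|h hs hz] := @farkas R d s z.
  move=> /coneP[t] zs; apply: zW; move: t z zs {sepz}.
  apply: wcone_elim => [||u x _ /sW xW]; rewrite ?mem0v //; last exact: memvZ.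
  by move=> *; apply: memvD.
move: hz; rewrite sepz ?ltxx // => x /coord_vbasis ->.
rewrite (raddf_sum (dot h)) big1 // => i _ /=.
rewrite dotZr; suff -> : dot h (vbasis W)`_i = 0 by rewrite mulr0.
have bi : (vbasis W)`_i \in vbasis W by rewrite mem_nth ?size_tuple.
apply/eqP; rewrite eq_le hs ?mem_cat ?bi // andbT -oppr_ge0 -dotNr hs //.
by rewrite mem_cat map_f ?orbT.
Qed.

End Hyperplane.

(** * Facets, their normals and the covering by facet cones *)

Section Polytope.
Context {R : realType} {d : nat}.
Local Notation E := 'rV[R]_d.
Implicit Types (F G : set E) (a b g h x y : E).
Context (P : set E) (P_polytope : polytope P) (P_full : affine_dim P d)
  (P_sym : centrally_symmetric P).

Lemma polytope_seq : exists s : seq E, P = wcone [set` s] 1.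
Proof.
by have [V /finite_seqP[s ->] ->] := P_polytope; exists s.
Qed.

Lemma polytopeN x : P x -> P (- x).
Proof. by move=> Px; rewrite P_sym; exists x. Qed.

(** By symmetry [h] vanishes on [P], so its kernel contains the direction of [P], which is the full
    space. *)
Lemma polytope_spans h : (forall x, P x -> dot h x <= 0) -> h = 0.
Proof.
move=> hP; have hP0 x : P x -> dot h x = 0.
  move=> Px; apply/eqP; rewrite eq_le hP //= -oppr_le0 -dotNr hP //.
  exact: polytopeN.
have [_ [U [_ Umin] dimU]] := P_full.
apply: dot_eq0 => x; apply/eqP; rewrite -mem_hyperplane.
have /subvP : (U <= hyperplane h)%VS.
  by apply: Umin => y z Py Pz; rewrite mem_hyperplane dotBr !hP0 ?subrr.
apply; suff -> : U = fullv by apply: memvf.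
by apply/eqP; rewrite eqEdim subvf dimU dimvf /dim /= mul1n.
Qed.

Lemma wcone_polytope t x : wcone P t x -> 0 < t -> P (t^-1 *: x).
Proof.
have [s Ps] := polytope_seq; rewrite Ps => xP t0.
rewrite -(mulVf (lt0r_neq0 t0)); apply: wconeZ; first by rewrite invr_ge0 ltW.
by apply: wcone_trans xP => y.
Qed.

(* [g] is the outer normal of the facet [F], normalised by [dot g = 1] on [F].
   Having dimension [d - 1] is replaced by spanning the whole space. *)
Definition facet_normal F g : Prop :=
  [/\ forall x, P x -> dot g x <= 1, F = P `&` [set x | dot g x = 1]
    & forall h, (forall x, F x -> dot h x = 0) -> h = 0].

Lemma facet_has_normal F : facet P F -> exists g, facet_normal F g.
Proof.
move=> [[f0 [t [ft FE]]] [k [[y Fy] [U [FU Umin] dimU]] kd]].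
have [f f0f] := scalar_dot f0.
have {}ft x : P x -> dot f x <= t by rewrite -f0f; apply: ft.
have {FE f0f} FP x : F x <-> P x /\ dot f x = t by rewrite FE /= f0f.
have [Py fy] : P y /\ dot f y = t by apply/FP.
have t_ge0 : 0 <= t.
  have := ft _ (polytopeN Py); rewrite dotNr fy => ?; lra.
have {t_ge0} t_gt0 : 0 < t.
  (* For [t = 0] the form would vanish, [F] would be all of [P], and its dimension would be too
     large. *)
  rewrite lt_neqAle t_ge0 andbT; apply/eqP => t0; rewrite -t0 in ft FP.
  have f_eq0 := polytope_spans ft.
  have [_ [V [_ Vmin] dimV]] := P_full.
  have /dimvS : (V <= U)%VS.
    by apply: Vmin => x z Px Pz; apply: FU; apply/FP; rewrite f_eq0 dot0l.
  by rewrite dimU dimV -kd ltnn.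
have FP' x : F x <-> P x /\ dot (t^-1 *: f) x = 1.
  rewrite FP dotZl; split=> -[Px]; first by move=> ->; rewrite mulVf ?gt_eqF.
  by move=> H; split=> //; rewrite -[LHS](mulVKf (lt0r_neq0 t_gt0)) H mulr1.
exists (t^-1 *: f); split.
- by move=> x /ft fx; rewrite dotZl mulrC ler_pdivrMr // mul1r.
- by apply/seteqP; split=> x /FP'.
move: (t^-1 *: f) FP' => {f0 f ft FP fy t_gt0} g FP h hF.
have [_ gy] : P y /\ dot g y = 1 by apply/FP.
(* Inclusion and equal dimension. Every [x] then splits into a multiple of [y] and a vector of [U],
   and [h] vanishes on both. *)
have UE : U = hyperplane g.
  apply/eqP; rewrite eqEdim; apply/andP; split.
    apply: Umin => x z /FP[_ gx] /FP[_ gz].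
    by rewrite mem_hyperplane dotBr gx gz subrr.
  rewrite dimU -ltnS kd dim_hyperplane // => g0.
  by move: gy; rewrite g0 dot0l => /eqP; rewrite eq_sym oner_eq0.
apply: dot_eq0 => x.
have : x - dot g x *: y \in U.
  by rewrite UE mem_hyperplane dotBr dotZr gy mulr1 subrr.
have /subvP Uh : (U <= hyperplane h)%VS.
  by apply: Umin => u z Fu Fz; rewrite mem_hyperplane dotBr !hF ?subrr.
by move=> /Uh; rewrite mem_hyperplane dotBr dotZr (hF y Fy) mulr0 subr0 => /eqP.
Qed.

(** Positive dimension matters: for [d = 0] the empty set spans and has a normal. *)
Lemma facet_normal_nonempty F g : (0 < d)%N -> facet_normal F g -> F !=set0.
Proof.
move=> d_gt0 [_ _ Fspan].
apply: contrapT => /set0P /negP; rewrite negbK => /eqP F0.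
have /rowP /(_ (Ordinal d_gt0)) : const_mx 1 = 0 :> E.
  by apply: Fspan => x; rewrite F0.
by rewrite !mxE => /eqP; rewrite oner_eq0.
Qed.

(** The direction of [F] is all of [hyperplane g]: a form [h] vanishing on differences of points of
    [F] is constant on [F], so it is a multiple of [g] by spanning. *)
Lemma facet_normal_facet F g : (0 < d)%N -> facet_normal F g -> facet P F.
Proof.
move=> d_gt0 Fg; have F0 := facet_normal_nonempty d_gt0 Fg.
have [gP FE Fspan] := Fg.
have FP x : F x <-> P x /\ dot g x = 1 by rewrite FE.
split; first by exists (dot g), 1; split.
exists d.-1; last by rewrite prednK.
have g0 : g <> 0.
  move=> g0; have [y /FP[_]] := F0; rewrite g0 dot0l => /eqP.
  by rewrite eq_sym oner_eq0.
split=> //; exists (hyperplane g).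
  2: exact (congr1 predn (dim_hyperplane g0)).
split=> [x y /FP[_ gx] /FP[_ gy]|W FW].
  by rewrite mem_hyperplane dotBr gx gy subrr.
apply/subvP => z; rewrite mem_hyperplane => /eqP gz.
apply: separate_vspace => h hW; have [y Fy] := F0.
have /Fspan/subr0_eq -> : forall x, F x -> dot (h - dot h y *: g) x = 0.
  move=> x Fx; have [_ gx] := (FP x).1 Fx.
  by rewrite dotBl dotZl gx mulr1 -dotBr hW // FW.
by rewrite dotZl gz mulr0.
Qed.

(** The weight of [x] over [F] is [dot g x]. It is an admissible factor by convexity of [P], and the
    least one since [dot g] is at most 1 on [P]. *)
Lemma cone_dist F g x : facet_normal F g -> cone F x -> dist P 0 x = dot g x.
Proof.
move=> [gP FE _] /coneP[t xF].
have gF y : F y -> dot g y = 1 by rewrite FE => -[].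
have FP : F `<=` P by rewrite FE => y [].
have gx : dot g x = t by rewrite (wcone_dot_eq gF xF) mulr1.
have t0 := wcone_ge0 xF.
have [[y Py] _] := P_full.
rewrite /dist subr0 gx.
have xS : [set u : R | 0 <= u /\ scale u P x] t.
  split=> //; have := t0; rewrite le_eqVlt => /predU1P[t0'|t_gt0].
    exists y => //; rewrite -t0' scale0r.
    by apply/esym/(@wcone_eq0 _ _ F); rewrite t0'.
  exists (t^-1 *: x); last by rewrite scalerA mulfV ?gt_eqF // scale1r.
  apply: wcone_polytope => //; apply: wcone_trans xF => z /FP; exact: wcone_mem.
have t_lb : lbound [set u : R | 0 <= u /\ scale u P x] t.
  move=> u [u0 [z Pz zx]]; rewrite -gx -zx dotZr ler_piMr //; exact: gP.
apply: xget_unique => // u [uS u_lb].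
by apply/eqP; rewrite eq_le u_lb // t_lb.
Qed.

(** The generators tight at a polar vertex span, so they cut out a facet; the vertex is chosen to be
    optimal for [x]. *)
Lemma cover_facet_cones x : (0 < d)%N ->
  exists F g, [/\ facet P F, facet_normal F g & cone F x].
Proof.
move=> d_gt0; have [s Ps] := polytope_seq.
have sP v : v \in s -> P v by move=> vs; rewrite Ps; apply: wcone_mem.
have Ple h c : (forall v, v \in s -> dot h v <= c) ->
    forall y, P y -> dot h y <= c.
  by move=> hs y; rewrite Ps => /(wcone_dot_le hs); rewrite mul1r.
have [h hs|g [gs gspan] xg] := @exists_polar_vertex R d s x.
  by apply: polytope_spans => y; apply: Ple.
pose F := P `&` [set y | dot g y = 1].
have Fg : facet_normal F g.
  split=> // [|h hF]; first exact: Ple.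
  by apply: gspan => v vs gv; apply: hF; split=> //; apply: sP.
exists F, g; split=> //; first exact: facet_normal_facet Fg.
by apply: cone_trans xg => v [vs gv]; apply: cone_mem; split=> //; apply: sP.
Qed.

End Polytope.

(** * Bisector pieces and what they reveal about facet cones *)

Section Bisectors.
Context {R : realType} {d : nat}.
Local Notation E := 'rV[R]_d.
Implicit Types (F G : set E) (a b c g h x y : E).
Context (P : set E) (P_polytope : polytope P) (P_full : affine_dim P d)
  (P_sym : centrally_symmetric P).

Lemma facet_normalN F g : facet_normal P F g ->
  facet_normal P [set - x | x in F] (- g).
Proof.
move=> [gP -> Fspan]; split=> [x Px||h hF].
- by rewrite dotNl -dotNr gP //; apply: polytopeN.
- apply/seteqP; split=> [_ [x [Px gx] <-]|x [Px gx]] /=.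
    by rewrite dotNl dotNr opprK; split=> //; apply: polytopeN.
  exists (- x); rewrite ?opprK //; split; first exact: polytopeN.
  by rewrite /= dotNr -dotNl.
- by apply: Fspan => x Fx; apply/eqP; rewrite -oppr_eq0 -dotNr hF //; exists x.
Qed.

(** Since [F] spans, every vector is a difference of two elements of [cone F]. Farkas' lemma needs
    finitely many generators, so [F] is first reduced to the generators of [P] lying on it. *)
Lemma facet_normal_cone_sub F g a : facet_normal P F g ->
  exists2 y, cone F y & cone F (y - a).
Proof.
move=> [gP FE Fspan]; have [s Ps] := polytope_seq P_polytope.
pose s' := [seq v <- s | dot g v == 1].
have s'F v : v \in s' -> F v.
  rewrite mem_filter FE => /andP[/eqP gv vs]; split=> //.
  by rewrite Ps; apply: wcone_mem.
(* an element of [F] puts no weight on a generator off [F] *)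
have Fs' x : F x -> cone [set` s'] x.
  rewrite FE Ps => -[xs /= gx].
  suff [_] : dot g x <= 1 /\ (dot g x = 1 -> cone [set` s'] x) by apply.
  move: xs {gx}; move: 1 x.
  apply: wcone_elim => [|t x u y [xt Hx] [yu Hy]|t x t0 /= xs].
  - by rewrite dot0r; split=> // _; apply: cone0.
  - rewrite dotDr; split; first exact: lerD.
    by move=> xy; apply: coneD; [apply: Hx|apply: Hy]; lra.
  - have gx : dot g x <= 1 by apply: gP; rewrite Ps; apply: wcone_mem.
    rewrite dotZr; split; first by rewrite ler_piMr.
    move: t0; rewrite le_eqVlt => /predU1P[<- _|t0 tg].
      by rewrite scale0r; apply: cone0.
    apply/coneZ/cone_mem; first exact: ltW.
    rewrite /= mem_filter xs andbT; apply/eqP/(mulfI (lt0r_neq0 t0)).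
    by rewrite tg mulr1.
have [/coneP[t]|] := pselect (cone [set` s' ++ map -%R s'] a).
  move: t a; apply: wcone_elim => [|t x u y [x' ? ?] [y' ? ?]|t x t0 /=].
  - by exists 0; rewrite ?subr0; apply: cone0.
  - by exists (x' + y'); rewrite ?opprD 1?addrACA; apply: coneD.
  - rewrite mem_cat => /orP[/s'F Fx|/mapP[v /s'F Fv ->]].
      by exists (t *: x); rewrite ?subrr; [apply/coneZ/cone_mem|apply: cone0].
    exists 0; rewrite ?scalerN ?opprK ?add0r; first exact: cone0.
    exact/coneZ/cone_mem.
move=> /farkas[h hs]; suff -> : h = 0 by rewrite dot0l ltxx.
apply: Fspan => x /Fs' /coneP[t] /(@wcone_dot_eq _ _ _ _ 0) ->.
  by rewrite mulr0.
move=> v /= vs; apply/eqP; rewrite eq_le hs ?mem_cat ?vs // andbT.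
by rewrite -oppr_ge0 -dotNr hs // mem_cat map_f ?orbT.
Qed.

Lemma dist0E a x : dist P a x = dist P 0 (x - a).
Proof. by rewrite /dist subr0. Qed.

Lemma bis_facets_nonempty F G a : bis_facets P F G 0 a !=set0 <->
  exists x, [/\ dist P 0 x = dist P 0 (x - a), cone F x & cone G (x - a)].
Proof.
split=> [[x [[xb [y Fy yx]] [z Gz zx]]]|[x [xb Fx Gx]]]; exists x.
  by rewrite -dist0E; split=> //; [rewrite -yx addr0|rewrite -zx addrK].
split; last by exists (x - a); rewrite ?subrK.
by split; [rewrite /bis /= xb -dist0E|exists x; rewrite ?addr0].
Qed.

(** A witness [x] writes [a] as the sum of [x] and [a - x], both in [cone F]. *)
Lemma bis_facets_opp F g a : facet_normal P F g ->
  bis_facets P F [set - x | x in F] 0 a !=set0 <-> cone F a.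
Proof.
move=> Fg; have Fg' := facet_normalN Fg.
rewrite bis_facets_nonempty; split=> [[x [_ Fx /coneN]]|Fa].
  by move=> Fx'; rewrite -[a](subrKC x) -opprB; apply: coneD.
have Fa2 : cone F (2^-1 *: a) by apply: coneZ; rewrite ?invr_ge0.
have FN : cone [set - x | x in F] (- (2^-1 *: a)).
  have : cone [set - x | x in [set - x | x in F]] (2^-1 *: a).
    apply: cone_trans Fa2 => x Fx; apply: cone_mem.
    by exists (- x); rewrite ?opprK //; exists x.
  by move=> /coneN.
have aE : 2^-1 *: a - a = - (2^-1 *: a).
  by rewrite -[X in _ - X]scale1r -scalerBl -scaleNr; congr (_ *: _); field.
exists (2^-1 *: a); rewrite aE; split=> //.
rewrite (cone_dist P_polytope P_full Fg) //.
by rewrite (cone_dist P_polytope P_full Fg') // dotNl dotNr opprK.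
Qed.

(** By [bis_facets_opp], membership in [cone F] depends only on the equivalence class, which is
    constant near [a]. *)
Lemma general_position_cone F g a : (0 < d)%N -> general_position P a ->
  facet_normal P F g -> cone F a -> \forall c \near a, cone F c.
Proof.
move=> d_gt0 a_gen Fg Fa; near=> c.
apply/(bis_facets_opp c Fg).
have ac : bis_equiv P 0 a 0 c by near: c.
have PF := facet_normal_facet d_gt0 Fg.
have PF' := facet_normal_facet d_gt0 (facet_normalN Fg).
exact/(ac F _ PF PF')/(bis_facets_opp a Fg).
Unshelve. all: by end_near. Qed.

(** A form that attains a local maximum is zero. *)
Lemma near_dot_le0 h a : (\forall c \near a, dot h c <= 0) -> 0 <= dot h a ->
  h = 0.
Proof.
move=> /nbhs_ballP[e /= e0 he] ha; apply: dot_eq0 => x; apply/eqP.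
suff hle y : dot h y <= 0 by rewrite eq_le hle -oppr_le0 -dotNr hle.
pose M := \sum_j `|y 0 j|.
have M0 : 0 <= M by apply: sumr_ge0.
(* [M] bounds every coordinate of [y], so [a + t *: y] stays in the coordinatewise ball of radius
   [e]. *)
pose t := e / (M + 1) / 2.
have t0 : 0 < t by rewrite !divr_gt0 // ltr_wpDl.
have : dot h (a + t *: y) <= 0.
  apply: he; split=> // i j; rewrite /ball /= ord1 !mxE opprD addNKr.
  rewrite normrN normrM (gtr0_norm t0).
  apply: (@le_lt_trans _ _ (t * M)).
    apply: ler_wpM2l; first exact: ltW.
    rewrite /M (bigD1 j) //= lerDl.
    by apply: sumr_ge0.
  rewrite /t -!mulrA gtr_pMr // ltr_pdivrMl; lra.
rewrite dotDr dotZr => hat; rewrite -(pmulr_rle0 _ t0); lra.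
Qed.

(** * The distance as a continuous gauge; sides of facet hyperplanes and cones of the fan *)

Section PositiveDim.
Context (d_gt0 : (0 < d)%N).

(** On a facet whose cone contains [x], [g] is at most 1 and the facet normal equals 1; the
    inequality extends to the cone, where the normal gives the distance. *)
Lemma dot_le_dist g x :
  (forall y, P y -> dot g y <= 1) -> dot g x <= dist P 0 x.
Proof.
move=> gP.
have [F [g' [_ Fg' Fx]]] := cover_facet_cones P_polytope P_full P_sym x d_gt0.
rewrite (cone_dist P_polytope P_full Fg' Fx).
have [_ FE _] := Fg'; move: Fx => /coneP[t xF].
rewrite (@wcone_dot_eq _ _ F g' 1 t x) //; last by move=> y; rewrite FE => -[].
by apply: wcone_dot_le xF => y; rewrite FE => -[/gP].
Qed.

Lemma dist0_ge0 x : 0 <= dist P 0 x.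
Proof. by rewrite -(dot0l x); apply: dot_le_dist => y _; rewrite dot0l. Qed.

(** The distance of [x + y] is the value of a linear form that nowhere exceeds the distance. *)
Lemma dist0D x y : dist P 0 (x + y) <= dist P 0 x + dist P 0 y.
Proof.
have [F [g [_ Fg Fx]]] :=
  cover_facet_cones P_polytope P_full P_sym (x + y) d_gt0.
rewrite (cone_dist P_polytope P_full Fg Fx) dotDr.
by have [gP _ _] := Fg; rewrite lerD // dot_le_dist.
Qed.

Lemma dist0Z_le t x : dist P 0 (t *: x) <= `|t| * (dist P 0 x + dist P 0 (- x)).
Proof.
have [F [g [_ Fg Fx]]] :=
  cover_facet_cones P_polytope P_full P_sym (t *: x) d_gt0.
rewrite (cone_dist P_polytope P_full Fg Fx) dotZr.
have [gP _ _] := Fg.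
have := dot_le_dist x gP; have := dot_le_dist (- x) gP; rewrite dotNr.
have := dist0_ge0 x; have := dist0_ge0 (- x) => ? ? ? ?.
rewrite (le_trans (ler_norm _)) // normrM ler_wpM2l // ler_norml.
by apply/andP; split; lra.
Qed.

(** Subadditivity makes the function Lipschitz with constant [M]. *)
Lemma dist0_ray_continuous x y :
  continuous (fun t : R => dist P 0 (t *: x + y)).
Proof.
pose M := dist P 0 x + dist P 0 (- x).
have M0 : 0 <= M by rewrite addr_ge0 ?dist0_ge0.
have lip t u : dist P 0 (t *: x + y) - dist P 0 (u *: x + y) <= `|t - u| * M.
  rewrite lerBlDr; have := dist0D ((t - u) *: x) (u *: x + y).
  rewrite addrA -scalerDl subrK => /le_trans; apply.
  by rewrite lerD2r dist0Z_le.
move=> t; apply/cvgrPdist_le => e e0.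
have e'0 : 0 < e / (M + 1) by rewrite divr_gt0 // ltr_wpDl.
near=> u.
have tu : `|t - u| < e / (M + 1) by near: u; apply: (nbhsx_ballx t).
apply: (@le_trans _ _ (`|t - u| * M)).
  by rewrite ler_norml lerNl opprB {1}distrC !lip.
rewrite (le_trans (ler_wpM2r M0 (ltW tu))) // mulrAC ler_pdivrMr ?ltr_wpDl //.
by rewrite ler_pM2l // lerDl.
Unshelve. all: by end_near. Qed.

(** At a witness [x], [dot g x - dot g a] is at most the distance from [a] to [x], which equals
    [dot g x]. *)
Lemma bis_facets_dot_ge0 F G g a : facet_normal P F g ->
  bis_facets P F G 0 a !=set0 -> 0 <= dot g a.
Proof.
move=> Fg /bis_facets_nonempty[x [+ Fx _]].
rewrite (cone_dist P_polytope P_full Fg Fx) => gx.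
by have [gP _ _] := Fg; have := dot_le_dist (x - a) gP; rewrite -gx dotBr; lra.
Qed.

(* Along a ray of [cone F] the distance to [a] is at first larger and finally
   smaller than the distance to [0]. *)
Lemma bis_facets_exists F g a : facet_normal P F g -> 0 < dot g a ->
  exists2 G, facet P G & bis_facets P F G 0 a !=set0.
Proof.
move=> Fg ga; have [y Fy Fya] := facet_normal_cone_sub a Fg.
pose phi (t : R) : R := dist P 0 (t *: y - a) - t * dot g y.
have phi0 : 0 <= phi 0 by rewrite /phi mul0r subr0 dist0_ge0.
(* As [y - a] is also in [cone F], its distance is [dot g y - dot g a]. *)
have phi1 : phi 1 <= 0.
  rewrite /phi scale1r mul1r (cone_dist P_polytope P_full Fg Fya) dotBr; lra.
have [|||c + phic] := @IVT R phi 0 1 0; first exact: ler01.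
- apply: continuous_subspaceT => t; apply: cvgB.
    exact: dist0_ray_continuous.
  by apply: cvgM; [exact: cvg_id|exact: cvg_cst].
- by rewrite ge_min le_max phi0 phi1 orbT.
rewrite in_itv /= => /andP[c0 _].
have [G [g' [PG _ Gx]]] :=
  cover_facet_cones P_polytope P_full P_sym (c *: y - a) d_gt0.
have Fcy : cone F (c *: y) by apply: coneZ.
exists G => //; apply/bis_facets_nonempty; exists (c *: y); split=> //.
by rewrite (cone_dist P_polytope P_full Fg) // dotZr; apply/esym/subr0_eq.
Qed.

Lemma bis_equiv_facet_side F g a b : facet P F -> facet_normal P F g ->
  dot g b < 0 < dot g a -> ~ bis_equiv P 0 a 0 b.
Proof.
move=> PF Fg /andP[gb ga] ab; have [G PG] := bis_facets_exists Fg ga.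
by move=> /(ab F G PF PG)/(bis_facets_dot_ge0 Fg); rewrite leNgt gb.
Qed.

(** The form [f] defining [H] is constant on [F], hence a multiple of the normal [g]; the product of
    its values at [a] and [b] only changes by a square. *)
Lemma facet_arrangement_separates H a b : facet_arrangement P H ->
  separates H a b ->
  exists F g, [/\ facet P F, facet_normal P F g & dot g a * dot g b < 0].
Proof.
move=> [_ [F PF FH]] [f0 [f0H]]; have [f f0f] := scalar_dot f0; rewrite !f0f.
have [g Fg] := facet_has_normal P_full P_sym PF => fab.
exists F, g; split=> //.
have [y Fy] := facet_normal_nonempty d_gt0 Fg; have [_ FE Fspan] := Fg.
have /Fspan/subr0_eq fE : forall x, F x -> dot (f - dot f y *: g) x = 0.
  move=> x Fx; have gx : dot g x = 1 by move: Fx; rewrite FE => -[].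
  by rewrite dotBl dotZl gx mulr1 -dotBr -f0f; apply/f0H/FH.
move: fab; rewrite fE !dotZl mulrACA -expr2 => fab.
rewrite ltNge; apply/negP => gab.
by move: fab; rewrite ltNge mulr_ge0 // sqr_ge0.
Qed.

(** The form [f - t *: g] is nonpositive on [cone F], hence near [a], and nonnegative on [cone C],
    hence at [a]. So it vanishes, and [C] and [F] are cut out by proportional forms. *)
Lemma face_cone_facet F g C a : facet_normal P F g -> face P C -> C `<` P ->
  cone C a -> (\forall c \near a, cone F c) -> C = F.
Proof.
move=> [gP FE _] [f0 [t [ft CE]]] [_ PC] Ca Fa.
have [f f0f] := scalar_dot f0.
have {}ft x : P x -> dot f x <= t by rewrite -f0f; apply: ft.
have CP x : C x <-> P x /\ dot f x = t by rewrite CE /= f0f.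
have t0 : 0 <= t.
  have [[y Py] _] := P_full.
  have := ft _ Py; have := ft _ (polytopeN P_sym Py); rewrite dotNr; lra.
have /subr0_eq fE : f - t *: g = 0.
  apply: (near_dot_le0 (a := a)).
    near=> c; have : cone F c by near: c.
    move=> /coneP[u cF]; rewrite dotBl dotZl subr_le0.
    rewrite (@wcone_dot_eq _ _ F g 1 u c) // => [|x]; last by rewrite FE => -[].
    by rewrite mulr1 mulrC; apply: wcone_dot_le cF => x; rewrite FE => -[/ft].
  move: Ca => /coneP[u aC]; rewrite dotBl dotZl subr_ge0.
  rewrite (@wcone_dot_eq _ _ C f t u a) // => [|x /CP[]//].
  rewrite [u * t]mulrC ler_wpM2l // -[u]mulr1.
  by apply: wcone_dot_le aC => x /CP[/gP].
(* Otherwise [f] would vanish and [C] would be all of [P]. *)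
have t_neq0 : t != 0.
  apply/eqP => t_eq0; apply: PC => x Px; apply/CP.
  by rewrite fE t_eq0 scale0r dot0l.
rewrite FE; apply/seteqP; split=> x /=.
  move=> /CP[Px]; rewrite fE dotZl => fx; split=> //.
  by apply: (mulfI t_neq0); rewrite fx mulr1.
by move=> [Px gx]; apply/CP; rewrite fE dotZl gx mulr1.
Unshelve. all: by end_near. Qed.

Lemma face_fan_facet C a : general_position P a -> face_fan P C -> C a ->
  exists F g, [/\ facet P F, facet_normal P F g, cone F a & C = cone F].
Proof.
move=> a_gen [C' [PC' C'P ->]] C'a.
have [F [g [PF Fg Fa]]] := cover_facet_cones P_polytope P_full P_sym a d_gt0.
suff -> : C' = F by exists F, g.
apply: (face_cone_facet Fg PC' C'P C'a).
exact: general_position_cone Fg Fa.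
Qed.

(** Equivalence carries membership in [cone F] from [a] to [b]. Near [b] both normals then compute
    the distance, so they coincide. *)
Lemma bis_equiv_cone F g G h a b : general_position P b ->
  facet_normal P F g -> facet_normal P G h -> cone F a -> cone G b ->
  bis_equiv P 0 a 0 b -> F = G.
Proof.
move=> b_gen Fg Gh Fa Gb ab.
have Fb : cone F b.
  have PF := facet_normal_facet d_gt0 Fg.
  have PF' := facet_normal_facet d_gt0 (facet_normalN Fg).
  exact/(bis_facets_opp b Fg)/(ab F _ PF PF')/(bis_facets_opp a Fg).
have gh c : cone F c -> cone G c -> dot (g - h) c = 0.
  move=> /(cone_dist P_polytope P_full Fg) gc.
  move=> /(cone_dist P_polytope P_full Gh) hc.
  by rewrite dotBl -gc -hc subrr.
suff /subr0_eq gE : g - h = 0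
    by case: Fg Gh => [_ -> _] [_ -> _]; rewrite gE.
apply: (near_dot_le0 (a := b)); last by rewrite gh.
near=> c; rewrite gh //; near: c.
  exact: general_position_cone Fg Fb.
exact: general_position_cone Gh Gb.
Unshelve. all: by end_near. Qed.

End PositiveDim.
End Bisectors.

Theorem proposition3p6 (R : realType) (d : nat) (P : set 'rV[R]_d)
    (P_polytope : polytope P) (P_full : affine_dim P d)
    (P_sym : centrally_symmetric P) (a b : 'rV[R]_d)
    (a_gen : general_position P a) (b_gen : general_position P b)
    (ab : (exists2 H, facet_arrangement P H & separates H a b) \/
          (exists C D, [/\ maximal_cone P C, maximal_cone P D, C <> D,
                           C a & D b])) :
  ~ bis_equiv P 0 a 0 b.
Proof.
move=> eq_ab.
case: ab => [[H PH Hab]|[C [D [[PC _] [PD _] CD Ca Db]]]].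
  have d_gt0 : (0 < d)%N by case: PH => dH _; rewrite -dH.
  have [F [g [PF Fg]]] := facet_arrangement_separates P_full P_sym d_gt0 PH Hab.
  (* If [dot g a] is negative, [a] and [b] exchange roles, equivalence being symmetric. *)
  have [ga|ga|->] := ltgtP (dot g a) 0; last by rewrite mul0r ltxx.
    rewrite nmulr_rlt0 // => gb.
    apply: (bis_equiv_facet_side P_polytope P_full P_sym d_gt0 PF Fg
      (a := b) (b := a)).
      by rewrite ga.
    by move=> G G' PG PG'; split=> /(eq_ab G G' PG PG').
  rewrite pmulr_rlt0 // => gb.
  apply: (bis_equiv_facet_side P_polytope P_full P_sym d_gt0 PF Fg) eq_ab.
  by rewrite gb.
(* In dimension 0 there is a single point, so [C] and [D], both nonempty, coincide. *)
have [d0|d_gt0] := posnP d.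
  have all_eq (x y : 'rV[R]_d) : x = y.
    by apply/rowP => i; have := ltn_ord i; rewrite [X in (_ < X)%N]d0.
  apply: CD; apply/seteqP.
  by split=> x _; [rewrite (all_eq x b)|rewrite (all_eq x a)].
have [F [g [_ Fg Fa CF]]] :=
  face_fan_facet P_polytope P_full P_sym d_gt0 a_gen PC Ca.
have [G [h [_ Gh Gb DG]]] :=
  face_fan_facet P_polytope P_full P_sym d_gt0 b_gen PD Db.
apply: CD; rewrite CF DG.
congr cone.
exact: (bis_equiv_cone P_polytope P_full P_sym d_gt0 b_gen Fg Gh Fa Gb eq_ab).
Qed.
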